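(* Let $l\ge1$, $n\ge 2$ and $d\ge n$ be integers, and let $\mathcal A=\{a_1<\dots<a_l\}$ be a totally ordered alphabet. Then every word over $\mathcal A$ of length at least $$\Psi(n,d,l)=2^{27}\, l\,(nd)^{3\log_3(nd)+9\log_3\log_3(nd)+36}$$ either contains a subword of the form $u^d$ for some nonempty word $u$, or is $n$-divisible.
   Context: Words are finite sequences of letters; a subword means a contiguous factor. Two words $u,v$ are called comparable if neither is a prefix of the other. For comparable $u,v$ write $u\succ v$ if at the first position where they differ the letter of $u$ is larger. A word $W$ is $n$-divisible if it contains a subword $u_1u_2\cdots u_n$ with nonempty $u_i$ and $u_1\succ u_2\succ\dots\succ u_n$. *)

(* Defs.v *)
(* words are lists of natural numbers; the alphabet
   {a_1 < ... < a_l} is represented by {0 < 1 < ... < l-1}. *)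
From Stdlib Require Import Reals List Arith.
Import ListNotations.
Open Scope R_scope.

Definition subword (v W : list nat) : Prop :=
  exists p s, W = p ++ v ++ s.

Definition is_prefix (u v : list nat) : Prop :=
  exists s, v = u ++ s.

Definition comparable (u v : list nat) : Prop :=
  ~ is_prefix u v /\ ~ is_prefix v u.

Definition word_gt (u v : list nat) : Prop :=
  comparable u v /\
  exists (p : list nat) (a b : nat) (u' v' : list nat),
    u = p ++ a :: u' /\ v = p ++ b :: v' /\ (b < a)%nat.

Definition word_pow (u : list nat) (d : nat) : list nat := concat (repeat u d).

Definition n_divisible (n : nat) (W : list nat) : Prop :=
  exists u : nat -> list nat,
    (forall i, (i < n)%nat -> u i <> []) /\
    (forall i, (S i < n)%nat -> word_gt (u i) (u (S i))) /\
    subword (concat (map u (seq 0 n))) W.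

Definition log3 (x : R) : R := ln x / ln 3.

Definition Psi (n d l : nat) : R :=
  let x := INR (n * d) in
  2 ^ 27 * INR l * Rpower x (3 * log3 x + 9 * log3 (log3 x) + 36).

(* Main.v *)
(** Suppose [W] is not [n]-divisible.  Cut a stretch of positions into blocks of
    length [m >= a], separated by gaps of length [m], and look at the factors of
    length [a] starting in them.  A decreasing choice of such factors in [n]
    successive blocks would make [W] [n]-divisible, so patience sorting shows
    that if only [K] factors of length [a] occur and there are more than
    [(n-1)K] blocks, then some block has at most [n-1] factors of length [a].
    Starting from [a = 1], [K = l] and doubling [a], with [K = (n-1)^2] each
    time, one finds a stretch of length [nd] with at most [n-1] factors of length
    [a >= n]; the stretch shrinks by a factor [2n^3] at each of about [log_2 n]
    doublings.  By the argument of Morse and Hedlund this stretch has a period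
    smaller than [n], up to a preperiod shorter than [n], and hence contains a
    [d]-th power. *)
Require Import Defs.
From Stdlib Require Import Reals List ListDec Arith Lia Lra.
Import ListNotations.
Local Open Scope nat_scope.

(** * Chains of decreasing values and patience sorting *)

(** The entries of [c] are start positions of factors; the gap [g] leaves room for a whole factor
    before the next start and before the end [e]. *)
Fixpoint chain (f : nat -> nat) (g e : nat) (c : list nat) : Prop :=
  match c with
  | [] => True
  | i :: c' =>
      i + g <= e /\
      match c' with [] => True | j :: _ => i + g <= j /\ f j < f i end /\
      chain f g e c'
  end.

Definition few (f : nat -> nat) (p s m : nat) : Prop :=
  exists L, length L <= p /\ forall i, s <= i < s + m -> In (f i) L.

(* The value at index [r] of a patience state is the least known first value of a chain of
   length [r + k + 1] starting at or after [s]. *)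
Fixpoint patience_state (f : nat -> nat) (g e s k : nat) (F : list nat) : Prop :=
  match F with
  | [] => True
  | v :: F' =>
      (exists i c, chain f g e (i :: c) /\ length c = k /\ f i = v /\ s <= i) /\
      (forall y, In y F' -> v < y) /\ patience_state f g e s (S k) F'
  end.

Definition count_ge (L : list nat) (v : nat) : nat :=
  length (filter (fun y => v <=? y) L).

(** Measures the progress of the scan: lowering an entry to a value in [L], or appending such a
    value, raises it. *)
Definition potential (L F : list nat) : nat := list_sum (map (count_ge L) F).

Lemma count_ge_le_length (L : list nat) (v : nat) : count_ge L v <= length L.
Proof. apply filter_length_le. Qed.

Lemma count_ge_mono (L : list nat) (v x : nat) :
  v <= x -> count_ge L x <= count_ge L v.
Proof.
  intros H; unfold count_ge; induction L as [|y L IH]; simpl; [lia|].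
  destruct (Nat.leb_spec x y), (Nat.leb_spec v y); simpl; lia.
Qed.

Lemma count_ge_lt (L : list nat) (v x : nat) :
  In v L -> v < x -> count_ge L x < count_ge L v.
Proof.
  intros Hin H; induction L as [|y L IH]; [destruct Hin|].
  pose proof (count_ge_mono L v x ltac:(lia)) as Hm.
  unfold count_ge in *; simpl; destruct Hin as [->|Hin].
  - destruct (Nat.leb_spec x v), (Nat.leb_spec v v); simpl; lia.
  - specialize (IH Hin).
    destruct (Nat.leb_spec x y), (Nat.leb_spec v y); simpl; lia.
Qed.

Lemma count_ge_pos (L : list nat) (v : nat) : In v L -> 0 < count_ge L v.
Proof. intros H; pose proof (count_ge_lt L v (S v) H); lia. Qed.

Lemma potential_bound (L F : list nat) : potential L F <= length F * length L.
Proof.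
  unfold potential; induction F as [|v F IH]; simpl; [lia|].
  pose proof (count_ge_le_length L v); lia.
Qed.

Lemma patience_state_anti (f : nat -> nat) (g e s s' : nat) (F : list nat) :
  forall k, s' <= s -> patience_state f g e s k F -> patience_state f g e s' k F.
Proof.
  induction F as [|v F IH]; intros k Hs H; simpl in *; [trivial|].
  destruct H as ((i & c & Hc & Hk & Hv & Hi) & Hlt & HF).
  split; [|split; auto].
  exists i, c; split; [exact Hc | repeat split; auto; lia].
Qed.

Lemma patience_state_chain (f : nat -> nat) (g e s : nat) (F : list nat) :
  forall k, patience_state f g e s k F -> F <> [] ->
  exists c, chain f g e c /\ length c = k + length F.
Proof.
  induction F as [|v F IH]; intros k H Hne; [congruence|].
  destruct H as ((i & c & Hc & Hk & _) & _ & HF).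
  destruct F as [|v' F].
  - exists (i :: c); simpl in *; split; [exact Hc | lia].
  - destruct (IH (S k) HF ltac:(discriminate)) as (c' & Hc' & Hl').
    exists c'; split; [exact Hc' | simpl in *; lia].
Qed.

(** The value [f i] replaces the first entry above it, or is appended. Its chain is [i] put before
    the chain [c] that witnesses the preceding, smaller entry. *)
Lemma patience_insert (f : nat -> nat) (g e s i : nat) (L F : list nat) :
  forall k c,
  In (f i) L -> i + g <= s -> ~ In (f i) F ->
  chain f g e (i :: c) -> length c = k ->
  patience_state f g e s k F ->
  exists F', patience_state f g e i k F' /\ potential L F < potential L F' /\
    length F' <= S (length F) /\ (forall y, In y F' -> y = f i \/ In y F).
Proof.
  induction F as [|x F IH]; intros k c HL Hs Hni Hc Hk HF.
  - exists [f i]; unfold potential; simpl; pose proof (count_ge_pos L _ HL).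
    repeat split; try lia; try (intros y []; auto); try tauto.
    exists i, c; auto.
  - destruct HF as ((j & cj & Hcj & Hkj & Hx & Hj) & Hlt & HF).
    assert (Hne : x <> f i) by (intros E; apply Hni; left; exact E).
    destruct (Nat.lt_ge_cases (f i) x) as [Hix|Hix].
    + exists (f i :: F); unfold potential; simpl.
      pose proof (count_ge_lt L _ _ HL Hix).
      repeat split; try lia.
      * exists i, c; auto.
      * intros y Hy; specialize (Hlt y Hy); lia.
      * apply (patience_state_anti f g e s); auto; lia.
      * intros y [<-|Hy]; auto.
    (* Here [x < f i] and [i + g <= s <= j], so [i] extends the chain of [x]. *)
    + destruct (IH (S k) (j :: cj)) as (F' & HF' & Hp & Hl & Hin); auto.
      * intros H; apply Hni; right; exact H.
      * split; [|split; [split; lia | exact Hcj]].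
        simpl in Hcj; lia.
      * simpl; lia.
      * exists (x :: F'); unfold potential in *; simpl; repeat split; try lia.
        -- exists j, cj; repeat split; auto; try apply Hcj; lia.
        -- intros y Hy; destruct (Hin y Hy) as [->|Hy']; [lia|auto].
        -- exact HF'.
        -- intros y [<-|Hy]; auto; destruct (Hin y Hy); auto.
Qed.

(* The blocks are scanned from the last one to the first, so that chains grow at their head. *)
Lemma patience_blocks (f : nat -> nat) (n m e : nat) (L : list nat) (T : nat) :
  1 <= n -> forall s, e = s + 2 * m * T ->
  (forall i, s <= i -> i + m < e -> In (f i) L) ->
  (exists t, s <= t /\ t + 2 * m <= e /\ few f (n - 1) t m) \/
  (exists c, length c = n /\ chain f m e c) \/
  (exists F, length F < n /\ patience_state f m e s 0 F /\ T <= potential L F).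
Proof.
  intros Hn; induction T as [|T IH]; intros s He HL.
  - right; right; exists []; simpl; repeat split; lia.
  - destruct (IH (s + 2 * m) ltac:(lia)) as [(t & H1 & H2 & H3)|[H|(F & HlF & HF & Hp)]].
    + intros i Hi; apply HL; lia.
    + left; exists t; repeat split; auto; lia.
    + auto.
    (* Either the block of length [m] at [s] takes only values from [F], fewer than [n] of them, or
       it has a new value to insert. *)
    + destruct (Forall_Exists_dec (fun i => In (f i) F)
                  (fun i => in_dec Nat.eq_dec (f i) F) (seq s m)) as [Hall|Hex].
      * left; exists s; repeat split; try lia.
        exists F; split; [lia|]; intros i Hi.
        rewrite Forall_forall in Hall; apply Hall, in_seq; lia.
      * apply Exists_exists in Hex; destruct Hex as (i & Hi & Hni).
        apply in_seq in Hi.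
        destruct (patience_insert f m e (s + 2 * m) i L F 0 []) as
          (F' & HF' & Hp' & Hl' & _); auto; try lia.
        { apply HL; lia. }
        { simpl; repeat split; lia. }
        destruct (Nat.eq_dec (length F') n) as [Hln|Hln].
        -- right; left.
           destruct (patience_state_chain f m e i F' 0 HF') as (c & Hc & Hlc).
           { intros ->; simpl in Hln; lia. }
           exists c; split; [simpl in Hlc; lia | exact Hc].
        -- right; right; exists F'; repeat split; try lia.
           apply (patience_state_anti f m e i); auto; lia.
Qed.

(** [T] insertions would bring the potential to [T], but a state with fewer than [n] entries has
    potential at most [(n - 1) * length L]. *)
Lemma few_block_or_chain (f : nat -> nat) (n m s T : nat) (L : list nat) :
  1 <= n -> (n - 1) * length L < T ->
  (forall i, s <= i -> i + m < s + 2 * m * T -> In (f i) L) ->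
  (exists t, s <= t /\ t + 2 * m <= s + 2 * m * T /\ few f (n - 1) t m) \/
  (exists c, length c = n /\ chain f m (s + 2 * m * T) c).
Proof.
  intros Hn HT HL.
  destruct (patience_blocks f n m _ L T Hn s eq_refl HL) as [H|[H|(F & HlF & _ & Hp)]];
    auto.
  pose proof (potential_bound L F); nia.
Qed.

(** * Factors coded as numbers *)

(* The factor of length [a] at position [i], read as a number in base [l]; on letters below [l] this turns
   the lexicographic order into the order of numbers. *)
Fixpoint code (l : nat) (w : nat -> nat) (a i : nat) : nat :=
  match a with
  | 0 => 0
  | S a' => code l w a' i * l + w (i + a')
  end.

Lemma code_add (l : nat) (w : nat -> nat) (a b i : nat) :
  code l w (a + b) i = code l w a i * l ^ b + code l w b (i + a).
Proof.
  induction b as [|b IH]; simpl.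
  - rewrite Nat.add_0_r; lia.
  - rewrite Nat.add_succ_r; simpl; rewrite IH, Nat.add_assoc; lia.
Qed.

Lemma code_eq (l : nat) (w : nat -> nat) (a i j : nat) : (forall t, w t < l) ->
  code l w a i = code l w a j -> forall t, t < a -> w (i + t) = w (j + t).
Proof.
  intros Hw; induction a as [|a IH]; intros H t Ht; [lia|]; simpl in H.
  pose proof (Hw (i + a)); pose proof (Hw (j + a)).
  assert (code l w a i = code l w a j) by nia.
  destruct (Nat.eq_dec t a) as [->|]; [nia | apply IH; lia].
Qed.

Lemma code_ext (l : nat) (w : nat -> nat) (a i j : nat) :
  (forall t, t < a -> w (i + t) = w (j + t)) -> code l w a i = code l w a j.
Proof.
  induction a as [|a IH]; intros H; simpl; [reflexivity|].
  rewrite IH, H; auto.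
Qed.

Lemma code_lt (l : nat) (w : nat -> nat) (a i j : nat) : (forall t, w t < l) ->
  code l w a j < code l w a i ->
  exists k, k < a /\ (forall t, t < k -> w (i + t) = w (j + t)) /\ w (j + k) < w (i + k).
Proof.
  intros Hw; induction a as [|a IH]; simpl; intros H; [lia|].
  pose proof (Hw (i + a)); pose proof (Hw (j + a)).
  destruct (Nat.lt_trichotomy (code l w a j) (code l w a i)) as [Hc|[Hc|Hc]].
  - destruct (IH Hc) as (k & Hk & He & Hlt); exists k; repeat split; auto; lia.
  - exists a; repeat split; [lia | | lia].
    apply (code_eq l); auto.
  - nia.
Qed.

Lemma map_seq_ext (w : nat -> nat) (a : nat) : forall i j,
  (forall t, t < a -> w (i + t) = w (j + t)) -> map w (seq i a) = map w (seq j a).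
Proof.
  induction a as [|a IH]; intros i j H; simpl; [reflexivity|].
  f_equal.
  - specialize (H 0 ltac:(lia)); rewrite !Nat.add_0_r in H; exact H.
  - apply IH; intros t Ht; specialize (H (S t) ltac:(lia)).
    rewrite !Nat.add_succ_r in H; exact H.
Qed.

Lemma subword_map_seq (w : nat -> nat) (N i a : nat) :
  i + a <= N -> subword (map w (seq i a)) (map w (seq 0 N)).
Proof.
  intros H; exists (map w (seq 0 i)), (map w (seq (i + a) (N - i - a))).
  rewrite <- !map_app; f_equal.
  replace N with (i + (a + (N - i - a))) at 1 by lia.
  rewrite !seq_app; reflexivity.
Qed.

Lemma word_gt_intro (p u v : list nat) (a b : nat) :
  b < a -> word_gt (p ++ a :: u) (p ++ b :: v).
Proof.
  intros H; split; [|exists p, a, b, u, v; auto].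
  split; intros [r Hr]; rewrite <- app_assoc in Hr; apply app_inv_head in Hr;
    simpl in Hr; injection Hr; lia.
Qed.

Lemma word_gt_code (l : nat) (w : nat -> nat) (a i j : nat) (r r' : list nat) :
  (forall t, w t < l) -> code l w a j < code l w a i ->
  word_gt (map w (seq i a) ++ r) (map w (seq j a) ++ r').
Proof.
  intros Hw H; destruct (code_lt l w a i j Hw H) as (k & Hk & He & Hlt).
  replace a with (k + S (a - k - 1)) by lia.
  rewrite !seq_app, !map_app, (map_seq_ext w k i j He); simpl.
  rewrite <- !app_assoc; apply word_gt_intro; exact Hlt.
Qed.

(** * From chains to divisibility *)

(** The word is cut at the chain positions. Since [a <= g], each piece begins with its coded factor,
    which decides the comparison; the last clause carries this prefix through the induction. *)
Lemma chain_words (l : nat) (w : nat -> nat) (a g e : nat) (c : list nat) :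
  (forall t, w t < l) -> 1 <= a <= g ->
  forall i, chain (code l w a) g e (i :: c) ->
  exists us, length us = S (length c) /\ concat us = map w (seq i (e - i)) /\
    (forall u, In u us -> u <> []) /\
    (forall k, S k < length us -> word_gt (nth k us []) (nth (S k) us [])) /\
    (exists r, nth 0 us [] = map w (seq i a) ++ r).
Proof.
  intros Hw Ha; induction c as [|j c IH]; intros i (Hi & Hn & Hc).
  - exists [map w (seq i (e - i))]; simpl; repeat split; try lia.
    + apply app_nil_r.
    + intros u [<-|[]] E.
      apply (f_equal (@length _)) in E; rewrite length_map, length_seq in E; simpl in E; lia.
    + exists (map w (seq (i + a) (e - i - a))).
      rewrite <- map_app, <- seq_app; do 2 f_equal; lia.
  - destruct Hn as (Hij & Hlt).
    destruct (IH j Hc) as (us & Hl & Hcat & Hne & Hgt & (r & Hr)).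
    assert (Hje : j + g <= e) by apply Hc.
    assert (Hp : map w (seq i (j - i)) = map w (seq i a) ++ map w (seq (i + a) (j - i - a))).
    { rewrite <- map_app, <- seq_app; do 2 f_equal; lia. }
    exists (map w (seq i (j - i)) :: us); simpl; split; [|split; [|split; [|split]]].
    + lia.
    + rewrite Hcat, <- map_app.
      replace (seq j (e - j)) with (seq (i + (j - i)) (e - j)) by (f_equal; lia).
      rewrite <- seq_app; do 2 f_equal; lia.
    + intros u [<-|Hu]; [|auto]; intros E.
      apply (f_equal (@length _)) in E; rewrite length_map, length_seq in E; simpl in E; lia.
    + intros [|k] Hk.
      * rewrite Hr, Hp; apply (word_gt_code l); auto.
      * apply Hgt; lia.
    + exists (map w (seq (i + a) (j - i - a))); exact Hp.
Qed.

Lemma chain_n_divisible (l : nat) (w : nat -> nat) (N a g e n : nat) (c : list nat) :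
  (forall t, w t < l) -> 1 <= a <= g -> e <= N -> 1 <= n -> length c = n ->
  chain (code l w a) g e c -> n_divisible n (map w (seq 0 N)).
Proof.
  intros Hw Ha He Hn Hl Hc; destruct c as [|i c]; [simpl in Hl; lia|].
  assert (Hie : i + g <= e) by apply Hc.
  destruct (chain_words l w a g e c Hw Ha i Hc) as (us & Hlu & Hcat & Hne & Hgt & _).
  simpl in Hl.
  exists (fun k => nth k us []); split; [|split].
  - intros k Hk; apply Hne, nth_In; lia.
  - intros k Hk; apply Hgt; lia.
  - replace (map (fun k => nth k us []) (seq 0 n)) with us.
    + rewrite Hcat; apply subword_map_seq; lia.
    + apply (nth_ext _ _ [] []).
      * rewrite length_map, length_seq; lia.
      * intros k Hk.
        (* [map_nth] needs as default the image of a default, here of [0]. *)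
        rewrite (nth_indep (map _ _) [] (nth 0 us []))
          by (rewrite length_map, length_seq; lia).
        rewrite (map_nth (fun k => nth k us [])), seq_nth by lia; reflexivity.
Qed.

(** * Doubling the factor length *)

(** A factor of length [2 * a] is a pair of factors of length [a], so at most [(n - 1) ^ 2] occur,
    and [n ^ 3] blocks exceed [(n - 1) ^ 3]. *)
Lemma few_double (l : nat) (w : nat -> nat) (N n a s m : nat) :
  (forall t, w t < l) -> 1 <= n -> 1 <= a -> 2 * a <= m -> s + 2 * n ^ 3 * m <= N ->
  few (code l w a) (n - 1) s (2 * n ^ 3 * m) ->
  n_divisible n (map w (seq 0 N)) \/
  exists t, t + m <= N /\ few (code l w (2 * a)) (n - 1) t m.
Proof.
  intros Hw Hn Ha Hm HN (L & HL & Hin).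
  destruct (few_block_or_chain (code l w (2 * a)) n m s (n ^ 3)
              (map (fun q => fst q * l ^ a + snd q) (list_prod L L)))
    as [(t & H1 & H2 & H3)|(c & Hl & Hc)]; auto.
  - rewrite length_map, length_prod.
    apply (Nat.le_lt_trans _ ((n - 1) ^ 3)); [|apply Nat.pow_lt_mono_l; lia].
    simpl; rewrite Nat.mul_1_r; apply Nat.mul_le_mono_l, Nat.mul_le_mono; exact HL.
  - intros i Hi1 Hi2.
    replace (2 * a) with (a + a) by lia; rewrite code_add.
    apply in_map_iff; exists (code l w a i, code l w a (i + a)); split; [reflexivity|].
    apply in_prod; apply Hin; lia.
  - right; exists t; split; [lia | exact H3].
  - left; apply (chain_n_divisible l w N (2 * a) m (s + 2 * m * n ^ 3) n c); auto; lia.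
Qed.

Lemma few_letters (l : nat) (w : nat -> nat) (N n m : nat) :
  (forall t, w t < l) -> 1 <= n -> 1 <= m -> 2 * n * l * m <= N ->
  n_divisible n (map w (seq 0 N)) \/
  exists t, t + m <= N /\ few (code l w 1) (n - 1) t m.
Proof.
  intros Hw Hn Hm HN; pose proof (Hw 0).
  destruct (few_block_or_chain (code l w 1) n m 0 (n * l) (seq 0 l))
    as [(t & H1 & H2 & H3)|(c & Hl & Hc)]; auto.
  - rewrite length_seq; nia.
  - intros i _ _; simpl; apply in_seq; specialize (Hw (i + 0)); lia.
  - right; exists t; split; [nia | exact H3].
  - left; apply (chain_n_divisible l w N 1 m (0 + 2 * m * (n * l)) n c); auto; nia.
Qed.

Lemma few_pow2 (l : nat) (w : nat -> nat) (N n k : nat) :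
  (forall t, w t < l) -> 1 <= n ->
  forall m, 2 ^ k <= m -> 2 * n * l * ((2 * n ^ 3) ^ k * m) <= N ->
  n_divisible n (map w (seq 0 N)) \/
  exists t, t + m <= N /\ few (code l w (2 ^ k)) (n - 1) t m.
Proof.
  intros Hw Hn; induction k as [|k IH]; intros m Hm HN.
  - rewrite Nat.pow_0_r, Nat.mul_1_l in HN; apply few_letters; auto.
  - assert (Hk : 1 <= 2 ^ k) by (apply Nat.neq_0_lt_0, Nat.pow_nonzero; lia).
    assert (Hn3 : 1 <= n ^ 3) by (apply Nat.neq_0_lt_0, Nat.pow_nonzero; lia).
    rewrite Nat.pow_succ_r' in Hm; rewrite Nat.pow_succ_r' in HN.
    (* The stretch found for length [2 ^ k] must be long enough to survive one more doubling. *)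
    destruct (IH (2 * n ^ 3 * m)) as [H|(t & Ht & Hf)]; [nia| |auto|].
    + replace ((2 * n ^ 3) ^ k * (2 * n ^ 3 * m))
        with (2 * n ^ 3 * (2 * n ^ 3) ^ k * m) by ring; exact HN.
    + rewrite Nat.pow_succ_r'; apply (few_double l w N n (2 ^ k) t m); auto.
Qed.

(** * Few factors force periodicity *)

(* Morse and Hedlund: if no length [k < a] predicted the next letter, then the number of
   factors would grow at every step up to length [a]. *)
Lemma determined_or_many (l : nat) (w : nat -> nat) (s m a : nat) :
  (forall t, w t < l) -> 1 <= m ->
  (exists k, k < a /\ forall i j, s <= i < s + m -> s <= j < s + m ->
     code l w k i = code l w k j -> w (i + k) = w (j + k)) \/
  (exists P, length P = S a /\ (forall i, In i P -> s <= i < s + m) /\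
     NoDup (map (code l w a) P)).
Proof.
  intros Hw Hm; induction a as [|a IH].
  - right; exists [s]; simpl; repeat split; try lia.
    repeat constructor; intros [].
  - destruct IH as [(k & Hk & H)|(P & HlP & HP & Hnd)].
    { left; exists k; split; [lia | exact H]. }
    set (R := list_prod (seq s m) (seq s m)).
    destruct (Forall_Exists_dec
      (fun q => code l w a (fst q) = code l w a (snd q) -> w (fst q + a) = w (snd q + a)))
      with (l := R) as [Hall|Hex].
    { intros (i, j); simpl.
      destruct (Nat.eq_dec (code l w a i) (code l w a j));
        destruct (Nat.eq_dec (w (i + a)) (w (j + a))); tauto. }
    + left; exists a; split; [lia|]; intros i j Hi Hj.
      rewrite Forall_forall in Hall; apply (Hall (i, j)).
      apply in_prod; apply in_seq; lia.
    + apply Exists_exists in Hex; destruct Hex as ((i, j) & Hq & Hnot).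
      apply in_prod_iff in Hq; rewrite !in_seq in Hq; simpl in Hnot; destruct Hq as (Hi & Hj).
      assert (Heq : code l w a i = code l w a j)
        by (destruct (Nat.eq_dec (code l w a i) (code l w a j)); tauto).
      assert (Hne : w (i + a) <> w (j + a)) by tauto.
      assert (Hdrop : forall x y, code l w (S a) x = code l w (S a) y ->
                code l w a x = code l w a y /\ w (x + a) = w (y + a)).
      { intros x y H; pose proof (code_eq l w _ x y Hw H) as He.
        split; [apply code_ext; intros; apply He; lia | apply He; lia]. }
      assert (Hnd' : NoDup (map (code l w (S a)) P)).
      (* Division by [l] removes the last letter, so the extended factors stay distinct. *)
      { apply (NoDup_map_inv (fun z => z / l)).
        rewrite map_map; erewrite map_ext; [exact Hnd|].
        intros x; simpl; specialize (Hw (x + a)).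
        rewrite Nat.div_add_l, Nat.div_small by lia; lia. }
      assert (Hadd : forall x, s <= x < s + m -> ~ In (code l w (S a) x) (map (code l w (S a)) P) ->
        exists P, length P = S (S a) /\ (forall i, In i P -> s <= i < s + m) /\
          NoDup (map (code l w (S a)) P)).
      { intros x Hx Hni; exists (x :: P); split; [simpl; lia|]; split.
        - intros y [<-|Hy]; auto.
        - constructor; auto. }
      right.
      destruct (in_dec Nat.eq_dec (code l w (S a) i) (map (code l w (S a)) P)) as [Ii|Ii];
        [|exact (Hadd i ltac:(lia) Ii)].
      destruct (in_dec Nat.eq_dec (code l w (S a) j) (map (code l w (S a)) P)) as [Ij|Ij];
        [|exact (Hadd j ltac:(lia) Ij)].
      (* Were both extensions present, at [x] and [y] in [P], their common prefix of length [a]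
         would force [x = y], against the differing last letters. *)
      exfalso.
      apply in_map_iff in Ii; destruct Ii as (x & Hx & HxP).
      apply in_map_iff in Ij; destruct Ij as (y & Hy & HyP).
      apply Hdrop in Hx; apply Hdrop in Hy.
      assert (x = y); [|subst; lia].
      assert (Hinj : forall Q, NoDup (map (code l w a) Q) -> In x Q -> In y Q ->
                code l w a x = code l w a y -> x = y).
      { induction Q as [|z Q IHQ]; simpl; intros Hn Hxq Hyq E; [tauto|].
        inversion_clear Hn as [|? ? Hz HQ].
        destruct Hxq as [->|Hxq], Hyq as [->|Hyq]; auto; exfalso; apply Hz.
        - rewrite E; apply in_map; auto.
        - rewrite <- E; apply in_map; auto. }
      apply (Hinj P); auto; lia.
Qed.

Lemma few_determined (l : nat) (w : nat -> nat) (p s m a : nat) :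
  (forall t, w t < l) -> 1 <= m -> p <= a -> few (code l w a) p s m ->
  exists k, k < a /\ forall i j, s <= i < s + m -> s <= j < s + m ->
     code l w k i = code l w k j -> w (i + k) = w (j + k).
Proof.
  intros Hw Hm Hp (L & HL & Hin).
  destruct (determined_or_many l w s m a Hw Hm) as [H|(P & HlP & HP & Hnd)]; [exact H|].
  exfalso.
  assert (Hle : length (map (code l w a) P) <= length L).
  { apply NoDup_incl_length; [exact Hnd|].
    intros z Hz; apply in_map_iff in Hz; destruct Hz as (i & <- & Hi); auto. }
  rewrite length_map in Hle; lia.
Qed.

Lemma pigeonhole_collision (f : nat -> nat) (L : list nat) (s q : nat) :
  length L < q -> (forall i, s <= i < s + q -> In (f i) L) ->
  exists i j, s <= i < j /\ j < s + q /\ f i = f j.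
Proof.
  intros Hq Hin.
  destruct (NoDup_dec Nat.eq_dec (map f (seq s q))) as [Hnd|Hd].
  - exfalso.
    assert (Hle : length (map f (seq s q)) <= length L).
    { apply NoDup_incl_length; [exact Hnd|].
      intros z Hz; apply in_map_iff in Hz; destruct Hz as (i & <- & Hi).
      apply in_seq in Hi; apply Hin; lia. }
    rewrite length_map, length_seq in Hle; lia.
  - clear Hq Hin; revert s Hd; induction q as [|q IH]; intros s Hd; simpl in Hd.
    + exfalso; apply Hd; constructor.
    + destruct (in_dec Nat.eq_dec (f s) (map f (seq (S s) q))) as [Hi|Hi].
      * apply in_map_iff in Hi; destruct Hi as (j & Hj & Hjs); apply in_seq in Hjs.
        exists s, j; repeat split; auto; lia.
      * destruct (IH (S s)) as (i & j & H1 & H2 & H3).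
        { intros Hnd; apply Hd; constructor; auto. }
        exists i, j; repeat split; auto; lia.
Qed.

(** Two of the first [p + 1] positions start the same factor of length [a]. It is longer than the
    [k] letters that determine the next one, so the agreement propagates to the end of the
    stretch. *)
Lemma few_periodic (l : nat) (w : nat -> nat) (p s m a : nat) :
  (forall t, w t < l) -> p < m -> p <= a -> few (code l w a) p s m ->
  exists i P, 1 <= P /\ s <= i /\ i + P <= s + p /\
    forall t, i + P + t < s + m -> w (i + t) = w (i + P + t).
Proof.
  intros Hw Hm Hp Hf.
  destruct (few_determined l w p s m a Hw ltac:(lia) Hp Hf) as (k & Hk & Hdet).
  destruct Hf as (L & HL & Hin).
  destruct (pigeonhole_collision (code l w a) L s (S p)) as (i & j & Hij & Hj & He).
  { lia. }
  { intros i Hi; apply Hin; lia. }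
  assert (Hstep : forall x y, s <= x < s + m -> s <= y < s + m ->
    (forall t, t < k -> w (x + t) = w (y + t)) -> forall t, t <= k -> w (x + t) = w (y + t)).
  { intros x y Hx Hy Hxy t Ht.
    destruct (Nat.eq_dec t k) as [->|]; [|apply Hxy; lia].
    apply Hdet; auto; apply code_ext; exact Hxy. }
  (* The invariant keeps [k + 1] equal letters, so that after a shift by one [k] of them remain to
     determine the next. *)
  assert (Hall : forall t, j + t < s + m -> forall r, r <= k -> w (i + t + r) = w (j + t + r)).
  { induction t as [|t IH]; intros Ht.
    - apply Hstep; [lia | lia |]; intros r Hr; rewrite !Nat.add_0_r.
      apply (code_eq l w a); auto; lia.
    - apply Hstep; [lia | lia |]; intros r Hr.
      specialize (IH ltac:(lia) (S r) ltac:(lia)).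
      replace (i + S t + r) with (i + t + S r) by lia.
      replace (j + S t + r) with (j + t + S r) by lia; exact IH. }
  exists i, (j - i); repeat split; try lia.
  intros t Ht; specialize (Hall t ltac:(lia) 0 ltac:(lia)).
  rewrite !Nat.add_0_r in Hall; rewrite Hall; f_equal; lia.
Qed.

(** * Powers in periodic stretches *)

Lemma periodic_word_pow (w : nat -> nat) (i P d : nat) :
  (forall t, P + t < P * d -> w (i + t) = w (i + P + t)) ->
  map w (seq i (P * d)) = word_pow (map w (seq i P)) d.
Proof.
  induction d as [|d IH]; intros H.
  - rewrite Nat.mul_0_r; reflexivity.
  - rewrite Nat.mul_succ_r, Nat.add_comm, seq_app, map_app; simpl.
    unfold word_pow; simpl; f_equal.
    rewrite <- (map_seq_ext w (P * d) i (i + P)).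
    + apply IH; intros t Ht; apply H; lia.
    + intros t Ht; apply H; lia.
Qed.

Lemma long_word_power_or_divisible (l : nat) (w : nat -> nat) (N n d k : nat) :
  (forall t, w t < l) -> 2 <= n -> 2 <= d -> n <= 2 ^ k <= 2 * n ->
  2 * n * l * ((2 * n ^ 3) ^ k * (n * d)) <= N ->
  (exists u : list nat, u <> [] /\ subword (word_pow u d) (map w (seq 0 N))) \/
  n_divisible n (map w (seq 0 N)).
Proof.
  intros Hw Hn Hd Hk HN.
  destruct (few_pow2 l w N n k Hw ltac:(lia) (n * d)) as [H|(s & Hs & Hf)];
    [nia | exact HN | auto |].
  left.
  destruct (few_periodic l w (n - 1) s (n * d) (2 ^ k) Hw) as (i & P & HP & Hi & HiP & Hper);
    [nia | lia | exact Hf |].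
  (* As [i - s + P <= n - 1], the end lies within [(n - 1) + P * (d - 1) <= (n - 1) * d] of [s]. *)
  assert (Hlen : i + P * d <= s + n * d) by nia.
  exists (map w (seq i P)); split.
  - intros E; apply (f_equal (@length _)) in E.
    rewrite length_map, length_seq in E; simpl in E; lia.
  - rewrite <- periodic_word_pow.
    + apply subword_map_seq; lia.
    + intros t Ht; apply Hper; lia.
Qed.

(** * Comparison with the bound [Psi], and conclusion *)

Lemma pow2_between (n : nat) : 1 <= n -> exists k, n <= 2 ^ k <= 2 * n.
Proof.
  intros Hn; exists (Nat.log2_up n).
  destruct (Nat.eq_dec n 1) as [->|]; [simpl; lia|].
  destruct (Nat.log2_up_spec n ltac:(lia)) as (H1 & H2).
  pose proof (Nat.log2_up_pos n ltac:(lia)).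
  split; [exact H2|].
  replace (Nat.log2_up n) with (S (Nat.pred (Nat.log2_up n))) by lia.
  rewrite Nat.pow_succ_r'; lia.
Qed.

(** Uses [2 * n <= n * d] and [2 * n ^ 3 = 2 * n * (n * n) <= (n * d) ^ 2]; the exponents add up to
    [1 + 2 * k + 1]. *)
Lemma length_bound_pow (n d l k : nat) :
  2 <= n -> n <= d ->
  2 * n * l * ((2 * n ^ 3) ^ k * (n * d)) <= l * (n * d) ^ (2 * k + 2).
Proof.
  intros Hn Hd.
  assert (H2 : 2 * n <= n * d) by nia.
  assert (H3 : 2 * n ^ 3 <= (n * d) ^ 2).
  { assert (n * n <= n * d) by nia.
    replace (2 * n ^ 3) with (2 * n * (n * n)) by (simpl; ring).
    rewrite Nat.pow_2_r; apply Nat.mul_le_mono; assumption. }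
  apply (Nat.pow_le_mono_l _ _ k) in H3.
  pose proof (Nat.mul_le_mono _ _ _ _ H2 H3) as H.
  rewrite Nat.pow_add_r, Nat.pow_mul_r, (Nat.pow_2_r (n * d)) in *.
  apply (Nat.mul_le_mono_l _ _ (l * (n * d))) in H; lia.
Qed.

Local Open Scope R_scope.

(** With [x = n * d], [3 ^ k <= (2 ^ k) ^ 2 <= 4 * n ^ 2 <= 9 * x] gives [k <= log3 x + 2], so
    [2 * k + 2 <= 2 * log3 x + 6], which is below the exponent in [Psi]. *)
Lemma Psi_ge_pow (n d l k : nat) :
  (2 <= n)%nat -> (n <= d)%nat -> (2 ^ k <= 2 * n)%nat ->
  INR (l * (n * d) ^ (2 * k + 2)) <= Psi n d l.
Proof.
  intros Hn Hd Hk; unfold Psi; cbv zeta.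
  assert (Hx4 : 4 <= INR (n * d)).
  { replace 4 with (INR 4) by (simpl; lra); apply le_INR; nia. }
  assert (H3k : (3 ^ k <= 9 * (n * d))%nat).
  { assert (3 ^ k <= 4 ^ k)%nat by (apply Nat.pow_le_mono_l; lia).
    assert (4 ^ k = 2 ^ k * 2 ^ k)%nat by (rewrite <- Nat.pow_mul_l; reflexivity).
    nia. }
  apply le_INR in H3k.
  rewrite pow_INR, mult_INR in H3k.
  replace (INR 3) with 3 in H3k by (simpl; lra).
  replace (INR 9) with (3 ^ 2) in H3k by (simpl; lra).
  rewrite mult_INR, pow_INR.
  set (x := INR (n * d)) in *.
  assert (Hln3 : 0 < ln 3) by (rewrite <- ln_1; apply ln_increasing; lra).
  assert (Hlog : INR k - 2 <= log3 x).
  { unfold log3.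
    assert (H : ln (3 ^ k) <= ln (3 ^ 2 * x)).
    { destruct H3k as [H|H]; [|rewrite H; lra].
      left; apply ln_increasing; [apply pow_lt; lra | exact H]. }
    rewrite ln_mult, !ln_pow in H by lra.
    replace (INR 2) with 2 in H by (simpl; lra).
    apply (Rmult_le_reg_r (ln 3)); [exact Hln3|].
    replace (ln x / ln 3 * ln 3) with (ln x) by (field; lra).
    lra. }
  assert (Hlog1 : 1 <= log3 x).
  { unfold log3; apply (Rmult_le_reg_r (ln 3)); [exact Hln3|].
    replace (ln x / ln 3 * ln 3) with (ln x) by (field; lra).
    rewrite Rmult_1_l; left; apply ln_increasing; lra. }
  (* The iterated logarithm is nonnegative because [x >= 4 > 3] makes [log3 x >= 1]. *)
  assert (Hloglog : 0 <= log3 (log3 x)).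
  { unfold log3 at 1; apply Rmult_le_pos; [|left; apply Rinv_0_lt_compat; exact Hln3].
    rewrite <- ln_1; destruct Hlog1 as [H|H]; [|rewrite <- H; lra].
    left; apply ln_increasing; lra. }
  assert (Hpow : x ^ (2 * k + 2) <=
                 Rpower x (3 * log3 x + 9 * log3 (log3 x) + 36)).
  { rewrite <- Rpower_pow by lra; apply Rle_Rpower; [lra|].
    rewrite plus_INR, mult_INR; replace (INR 2) with 2 by (simpl; lra).
    pose proof (pos_INR k); lra. }
  assert (0 <= x ^ (2 * k + 2)) by (apply pow_le; lra).
  assert (0 <= INR l) by apply pos_INR.
  rewrite Rmult_assoc, <- (Rmult_1_l (INR l * x ^ (2 * k + 2))).
  apply Rmult_le_compat; [lra | apply Rmult_le_pos; lra | simpl; lra |].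
  apply Rmult_le_compat_l; lra.
Qed.

Theorem theoremc (l n d : nat) (hl : (1 <= l)%nat) (hn : (2 <= n)%nat)
  (hd : (n <= d)%nat) (W : list nat) (hW : Forall (fun x => (x < l)%nat) W)
  (hlen : Psi n d l <= INR (length W)) :
  (exists u : list nat, u <> [] /\ subword (word_pow u d) W) \/ n_divisible n W.
Proof.
  destruct (pow2_between n ltac:(lia)) as (k & Hk).
  (* The default [0] is itself a letter since [1 <= l], so the extended word stays below [l]
     everywhere. *)
  set (w := fun i => nth i W 0%nat).
  assert (Hw : forall t, (w t < l)%nat).
  { intros t; unfold w; destruct (nth_in_or_default t W 0%nat) as [H| ->]; [|lia].
    rewrite Forall_forall in hW; auto. }
  assert (HW : map w (seq 0 (length W)) = W).
  { apply (nth_ext _ _ (w 0%nat) 0%nat).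
    - rewrite length_map, length_seq; reflexivity.
    - intros i Hi; rewrite length_map, length_seq in Hi.
      rewrite map_nth, seq_nth by exact Hi; reflexivity. }
  rewrite <- HW.
  apply (long_word_power_or_divisible l w (length W) n d k); auto; [lia|].
  apply (Nat.le_trans _ _ _ (length_bound_pow n d l k hn hd)), INR_le.
  apply (Rle_trans _ (Psi n d l)); [|exact hlen].
  apply Psi_ge_pow; auto; lia.
Qed.
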